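(* Let $n\geqslant 6$ and let $i$ be an integer with $1<i<n-2$, $i\neq 2$. Then $S_{\{i,n-2\}_{n}^{2}}$ is Laplacian realizable if and only if one of the following holds: (i) $n\equiv 0\pmod 4$ and $i=2k+2$ for some $k\in\{1,2,\ldots,\frac{n-6}{2}\}$; (ii) $n\equiv 1\pmod 4$ and $i=2k+2$ for some $k\in\{1,2,\ldots,\frac{n-5}{2}\}$; (iii) $n\equiv 2\pmod 4$ and $i=2k+1$ for some $k\in\{1,2,\ldots,\frac{n-4}{2}\}$; (iv) $n\equiv 3\pmod 4$ and $i=2k+1$ for some $k\in\{1,2,\ldots,\frac{n-5}{2}\}$.
   Context: For a simple graph $G$, its Laplacian spectrum is the multiset of eigenvalues of $L(G)=D-A$. For integers $0<i<j\leqslant n$ and $m\in\{1,\dots,n\}\setminus\{i,j\}$, $S_{\{i,j\}_{n}^{m}}$ denotes the multiset $\{0,1,\ldots,m-1,m,m,m+1,\ldots,n\}\setminus\{i,j\}$. A multiset $S$ is Laplacian realizable if some simple connected graph has Laplacian spectrum (with multiplicities) equal to $S$. *)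

(* Defs.v *)
From mathcomp Require Import all_boot all_order all_algebra all_field.

Set Implicit Arguments.
Unset Strict Implicit.
Unset Printing Implicit Defensive.

Import GRing.Theory.

Local Open Scope ring_scope.

(* A simple graph of order N is a symmetric irreflexive relation on 'I_N.
   Multisets are sequences considered up to perm_eq. *)

Definition simple_graph (N : nat) (e : rel 'I_N) : Prop :=
  symmetric e /\ irreflexive e.

(* The graph of order 0 is not considered connected. *)
Definition connected_graph (N : nat) (e : rel 'I_N) : Prop :=
  (0 < N)%N /\ forall x y : 'I_N, connect e x y.

Definition degree (N : nat) (e : rel 'I_N) (x : 'I_N) : nat :=
  #|[set y | e x y]|.

Definition degree_mx (N : nat) (e : rel 'I_N) : 'M[algC]_N :=
  diag_mx (\row_x (degree e x)%:R).

Definition adjacency_mx (N : nat) (e : rel 'I_N) : 'M[algC]_N :=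
  \matrix_(x, y) (e x y)%:R.

Definition laplacian (N : nat) (e : rel 'I_N) : 'M[algC]_N :=
  degree_mx e - adjacency_mx e.

(* The roots of the characteristic polynomial, repeated according to their
   multiplicity; algC contains all the eigenvalues of an integer matrix. *)
Definition spectrum (N : nat) (M : 'M[algC]_N) : seq algC :=
  sval (closed_field_poly_normal (char_poly M)).

Definition laplacian_spectrum (N : nat) (e : rel 'I_N) : seq algC :=
  spectrum (laplacian e).

Definition laplacian_realizable (S : seq algC) : Prop :=
  exists (N : nat) (e : rel 'I_N),
    [/\ simple_graph e, connected_graph e & perm_eq (laplacian_spectrum e) S].

(* S_{{i,j}_n^m}, meant for 0 < i < j <= n and m in {1, ..., n} \ {i, j}. *)
Definition S_ij_nm (i j n m : nat) : seq nat :=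
  rem j (rem i (iota 0 m.+1 ++ iota m (n - m).+1)).

Definition natC (s : seq nat) : seq algC := [seq k%:R | k <- s].

(* Main.v *)
(* If S is realizable, then it is the spectrum of a graph on n vertices, and the
   trace of its Laplacian is twice the number of edges, so the sum of S is even.
   For 3 <= i <= n - 3, the listed cases say exactly that this sum is even.

   Conversely, complementation maps the spectrum 0 :: s of a graph on n vertices
   to 0 :: [seq n - k | k <- s], and disjoint union concatenates spectra. Alternating
   the two operations builds, by induction on m, a graph with spectrum
   {0, .., m} \ {j} whenever 0 < j < m and the sum is even. The required graph is
   obtained from such a graph with m = n - 5 and j = i - 2 (or m = n - 6 and j = 2,
   when i = n - 3 > 3; a single vertex when n = 6): add isolated components to get three components, take the
   complement, then three times in a row add an isolated vertex and take the
   complement. *)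
Require Import Defs.
From mathcomp Require Import all_boot all_order all_algebra all_field.
From mathcomp Require Import zify ring.

(** * Characteristic polynomials under adding the all-ones matrix and under reflection *)

Section CharPoly.
Set Implicit Arguments.
Unset Strict Implicit.
Import GRing.Theory Num.Theory.
Local Open Scope ring_scope.

(** The all-ones matrix is the rank-one product [u *m v], so the bordered matrix [B] can be reduced
    along either diagonal block. The factor [y] on the left avoids the exponent [n - 1]. *)
Lemma det_scalar_sub_const1 (R : comNzRingType) n (y : R) :
  \det (y%:M - const_mx 1 : 'M_n) * y = y ^+ n * (y - n%:R).
Proof.
pose u : 'cV[R]_n := const_mx 1; pose v : 'rV[R]_n := const_mx 1.
have uv : u *m v = const_mx 1.
  by apply/matrixP => i j; rewrite !mxE big_ord1 !mxE mulr1.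
have vu : v *m u = n%:R%:M.
  apply/matrixP => i j; rewrite !mxE !ord1 eqxx mulr1n.
  under eq_bigr do rewrite !mxE mulr1.
  by rewrite sumr_const card_ord.
pose B := block_mx y%:M u v (1%:M : 'M_1).
have -> : \det (y%:M - const_mx 1 : 'M_n) = \det B.
  have -> : B = block_mx 1%:M u 0 1%:M *m block_mx (y%:M - u *m v) 0 v 1%:M.
    by rewrite mulmx_block !mul1mx !mul0mx !mulmx1 !add0r subrK.
  by rewrite det_mulmx det_ublock det_lblock !det1 uv !mul1r mulr1.
have : B *m block_mx 1%:M (- u) 0 y%:M = block_mx y%:M 0 v (y%:M - v *m u).
  rewrite mulmx_block !mulmx1 !mulmx0 !addr0 mul1mx !mulmxN mul_scalar_mx.
  by rewrite mul_mx_scalar addNr [- _ + _]addrC.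
move/(congr1 (@determinant _ _)).
rewrite det_mulmx det_ublock det_lblock det1 mul1r vu !det_scalar expr1 => ->.
by rewrite det_mx11 !mxE eqxx !mulr1n.
Qed.

(** With [J] the all-ones matrix, [M J = 0] gives [('X - M)('X - J) = 'X ('X - (M + J))]. Taking
    determinants, one eigenvalue 0 is replaced by [n]. *)
Lemma char_poly_add_const1 (R : idomainType) n (M : 'M[R]_n) (p : {poly R}) :
  M *m const_mx 1 = 0 :> 'M_n -> char_poly M = 'X * p ->
  char_poly (M + const_mx 1) = p * ('X - n%:R%:P).
Proof.
move=> MJ0 charM.
have : char_poly_mx M *m ('X%:M - const_mx 1)
       = 'X *: char_poly_mx (M + const_mx 1).
  rewrite /char_poly_mx map_mxD map_const_mx mulmxBl !mulmxBr.
  have -> : map_mx polyC M *m const_mx 1 = 0 :> 'M_n.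
    have J1 : const_mx 1 = map_mx polyC (const_mx (1 : R) : 'M_n).
      by apply/matrixP => i j; rewrite !mxE.
    by rewrite J1 -map_mxM MJ0 map_mx0.
  rewrite subr0 !mul_mx_scalar mul_scalar_mx.
  by rewrite -!scalerBr [_ + const_mx _]addrC opprD addrA.
move/(congr1 (@determinant _ _)); rewrite det_mulmx detZ -!/(char_poly _) charM.
move/(congr1 ( *%R^~ 'X)); rewrite -mulrA det_scalar_sub_const1 => eq_p.
have X0 : 'X^n * 'X != 0 :> {poly R} by rewrite mulf_neq0 ?expf_neq0 ?polyX_eq0.
apply: (mulfI X0); rewrite mulrAC -eq_p polyC_natr; ring.
Qed.

Lemma char_poly_scalar_sub (R : comNzRingType) n (M : 'M[R]_n) (c : R) s :
  char_poly M = \prod_(x <- s) ('X - x%:P) ->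
  char_poly (c%:M - M) = \prod_(x <- s) ('X - (c - x)%:P).
Proof.
move=> charM.
have size_s : size s = n.
  by have := size_char_poly M; rewrite charM size_prod_XsubC => -[].
(* Since ['X - (c - M) = - ((c - 'X) - M)]. *)
have -> : char_poly (c%:M - M) = (-1) ^+ n * (char_poly M \Po (c%:P - 'X)).
  rewrite -det_map_mx -detZ; congr (\det _).
  apply/matrixP => i j; rewrite !mxE /= polyCB comp_polyB comp_polyC.
  by case: (i == j); rewrite ?comp_polyX ?raddf0 /=; ring.
rewrite charM rmorph_prod -size_s /=.
elim: s {charM size_s} => [|x s IHs]; first by rewrite !big_nil mulr1.
rewrite !big_cons -IHs exprS rmorphB /= comp_polyX comp_polyC polyCB; ring.
Qed.

End CharPoly.

(** * Laplacians of complements and disjoint unions, and their traces *)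

Section Graphs.
Set Implicit Arguments.
Unset Strict Implicit.
Import GRing.Theory Num.Theory.
Local Open Scope ring_scope.

Lemma laplacian_spectrumP n (e : rel 'I_n) s :
  perm_eq (laplacian_spectrum e) s <->
  char_poly (laplacian e) = \prod_(x <- s) ('X - x%:P).
Proof.
have spec : char_poly (laplacian e) =
            \prod_(x <- laplacian_spectrum e) ('X - x%:P).
  rewrite /laplacian_spectrum /spectrum; case: closed_field_poly_normal => /= r.
  by rewrite (eqP (char_poly_monic _)) scale1r.
split=> eq_s; first by rewrite spec; apply: perm_big.
by apply: prod_XsubC_eq; rewrite -spec.
Qed.

Lemma laplacianE n (e : rel 'I_n) x y :
  laplacian e x y = (degree e x)%:R *+ (x == y) - (e x y)%:R.
Proof. by rewrite !mxE. Qed.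

Lemma laplacian_mul_const1 n (e : rel 'I_n) :
  laplacian e *m const_mx 1 = 0 :> 'M_n.
Proof.
apply/matrixP => x z; rewrite !mxE.
under eq_bigr do rewrite !mxE mulr1.
rewrite sumrB (bigD1 x) //= eqxx mulr1n big1 ?addr0 => [|y]; last first.
  by rewrite eq_sym => /negPf ->.
by rewrite -natr_sum -big_mkcond /= sum1dep_card subrr.
Qed.

Definition compl_rel n (e : rel 'I_n) : rel 'I_n :=
  fun x y => (x != y) && ~~ e x y.

Lemma simple_compl n (e : rel 'I_n) : simple_graph e -> simple_graph (compl_rel e).
Proof.
case=> sym_e irr_e; split=> [x y | x]; last by rewrite /compl_rel eqxx.
by rewrite /compl_rel eq_sym sym_e.
Qed.

Lemma laplacian_compl n (e : rel 'I_n) : irreflexive e ->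
  laplacian (compl_rel e) = n%:R%:M - (laplacian e + const_mx 1).
Proof.
move=> irr_e; apply/matrixP => x y; rewrite laplacianE !mxE.
have [<-{y} | neq_xy] := eqVneq x y; last first.
  by rewrite /compl_rel neq_xy /= !mulr0n; case: (e x y) => /=; ring.
(* Every vertex other than [x] is adjacent to [x] in exactly one of the two graphs. *)
have deg_compl : (degree (compl_rel e) x + degree e x).+1 = n.
  rewrite -[RHS]card_ord -(cardC (pred1 x)) card1 add1n; congr _.+1.
  rewrite -cardsUI.
  have -> : [set y | compl_rel e x y] :&: [set y | e x y] = set0.
    by apply/setP => y; rewrite !inE /compl_rel -andbA andNb andbF.
  rewrite cards0 addn0; apply: eq_card => y; rewrite !inE /compl_rel eq_sym.
  by case: eqP => [-> | _] /=; rewrite ?irr_e ?orNb.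
have -> : n%:R = (degree (compl_rel e) x)%:R + (degree e x)%:R + 1 :> algC.
  by rewrite -[in LHS]deg_compl -natr1 natrD.
rewrite {2}/compl_rel eqxx irr_e !mulr1n /=; ring.
Qed.

Definition disj_rel m n (e : rel 'I_m) (f : rel 'I_n) : rel 'I_(m + n) :=
  fun x y => match split x, split y with
             | inl x1, inl y1 => e x1 y1
             | inr x2, inr y2 => f x2 y2
             | _, _ => false
             end.

Lemma simple_disj m n (e : rel 'I_m) (f : rel 'I_n) :
  simple_graph e -> simple_graph f -> simple_graph (disj_rel e f).
Proof.
move=> [sym_e irr_e] [sym_f irr_f]; split=> [x y | x]; rewrite /disj_rel.
  by case: (split x) => x1; case: (split y) => y1.
by case: (split x) => x1.
Qed.

Lemma split_lshift m n (x : 'I_m) : split (lshift n x) = inl x.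
Proof. exact: (unsplitK (inl x)). Qed.

Lemma split_rshift m n (x : 'I_n) : split (rshift m x) = inr x.
Proof. exact: (unsplitK (inr x)). Qed.

Lemma laplacian_disj m n (e : rel 'I_m) (f : rel 'I_n) :
  laplacian (disj_rel e f) = block_mx (laplacian e) 0 0 (laplacian f).
Proof.
have deg_l x : degree (disj_rel e f) (lshift n x) = degree e x.
  rewrite /degree -!sum1dep_card big_split_ord /= /disj_rel split_lshift.
  rewrite [X in (_ + X)%N]big_pred0 ?addn0 => [|y]; last by rewrite split_rshift.
  by apply: eq_bigl => y; rewrite split_lshift.
have deg_r x : degree (disj_rel e f) (rshift m x) = degree f x.
  rewrite /degree -!sum1dep_card big_split_ord /= /disj_rel split_rshift.
  rewrite [X in (X + _)%N]big_pred0 ?add0n => [|y]; last by rewrite split_lshift.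
  by apply: eq_bigl => y; rewrite split_rshift.
apply/matrixP => x y; rewrite laplacianE !mxE.
case: (split_ordP x) => x1 ->; rewrite !mxE; case: (split_ordP y) => y1 -> /=.
- by rewrite deg_l /disj_rel !split_lshift (inj_eq (@lshift_inj _ _)) laplacianE.
- by rewrite /disj_rel split_lshift split_rshift eq_lrshift mulr0n subr0 mxE.
- by rewrite /disj_rel split_lshift split_rshift eq_rlshift mulr0n subr0 mxE.
- by rewrite deg_r /disj_rel !split_rshift (inj_eq (@rshift_inj _ _)) laplacianE.
Qed.

(** The leading 0 belongs to the all-ones vector: adding the all-ones matrix moves it to [n], and
    the reflection in [n] brings it back to 0. *)
Lemma laplacian_spectrum_compl n (e : rel 'I_n) s :
  simple_graph e -> perm_eq (laplacian_spectrum e) (0 :: s) ->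
  perm_eq (laplacian_spectrum (compl_rel e)) (0 :: [seq n%:R - x | x <- s]).
Proof.
move=> [_ irr_e] /laplacian_spectrumP; rewrite big_cons subr0 => charL.
apply/laplacian_spectrumP; rewrite laplacian_compl //.
rewrite (@char_poly_scalar_sub _ _ _ _ (n%:R :: s)); last first.
  rewrite (char_poly_add_const1 (laplacian_mul_const1 e) charL).
  by rewrite big_cons mulrC.
by rewrite !big_cons big_map subrr.
Qed.

Lemma laplacian_spectrum_disj m n (e : rel 'I_m) (f : rel 'I_n) s t :
  perm_eq (laplacian_spectrum e) s -> perm_eq (laplacian_spectrum f) t ->
  perm_eq (laplacian_spectrum (disj_rel e f)) (s ++ t).
Proof.
move=> /laplacian_spectrumP chare /laplacian_spectrumP charf.
apply/laplacian_spectrumP; rewrite laplacian_disj /char_poly char_block_diag_mx.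
by rewrite det_lblock big_cat -chare -charf.
Qed.

(** The eigenvalues sum to the trace, which is the sum of the degrees; the handshake lemma
    concludes. *)
Lemma odd_sum_laplacian_spectrum n (e : rel 'I_n) (s : seq nat) :
  simple_graph e -> perm_eq (laplacian_spectrum e) (natC s) ->
  odd (sumn s) = false.
Proof.
move=> [sym_e irr_e] /laplacian_spectrumP charL.
have size_s : size (natC s) = n.
  by have := size_char_poly (laplacian e); rewrite charL size_prod_XsubC => -[].
(* The trace is read off the coefficient of degree [n - 1], so order 0 is treated apart. *)
case: n => [|n] in e sym_e irr_e charL size_s *.
  by move: size_s; rewrite size_map; case: s charL.
have := char_poly_trace (laplacian e) isT.
rewrite charL -{1}size_s coefPn_prod_XsubC ?size_s // => /oppr_inj.
rewrite big_map -natr_sum.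
have -> : \tr (laplacian e) = (\sum_x degree e x)%:R.
  by rewrite natr_sum; apply: eq_bigr => x _; rewrite laplacianE eqxx irr_e subr0.
move/eqP; rewrite eqr_nat -sumnE => /eqP ->.
have -> : (\sum_x degree e x = \sum_x \sum_y e x y)%N.
  by apply: eq_bigr => x _; rewrite /degree -sum1dep_card big_mkcond.
have -> : (\sum_x \sum_y e x y =
  \sum_(x : 'I_n.+1) \sum_(y < n.+1 | (x < y)%N) e x y
  + \sum_(x : 'I_n.+1) \sum_(y < n.+1 | (y < x)%N) e x y)%N.
  rewrite -big_split; apply: eq_bigr => x _.
  rewrite (bigID (fun y : 'I__ => (x < y)%N)) /=; congr addn.
  rewrite (bigD1 x) ?ltnn //= irr_e add0n; apply: eq_bigl => y.
  by rewrite -leqNgt ltn_neqAle andbC.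
rewrite [X in (_ + X)%N](exchange_big_dep xpredT) //=.
under [X in (_ + X)%N]eq_bigr do under eq_bigr do rewrite sym_e.
by rewrite addnn odd_double.
Qed.

End Graphs.

(** * Integral spectra closed under complement and union *)

Section Constructions.
Import GRing.Theory.
Set Implicit Arguments.
Unset Strict Implicit.

(** Connectedness is left out because the construction passes through disconnected graphs. *)
Definition graph_spectrum n (s : seq nat) : Prop :=
  exists e : rel 'I_n,
    simple_graph e /\ perm_eq (laplacian_spectrum e) (natC s).

Lemma graph_spectrum_perm n s t :
  perm_eq s t -> graph_spectrum n s -> graph_spectrum n t.
Proof.
move=> st [e [simp_e spec_e]]; exists e; split=> //.
exact: perm_trans spec_e (perm_map _ st).
Qed.

Lemma natC_sub n s : all (leq^~ n) s ->
  natC [seq n - k | k <- s] = [seq (n%:R - x)%R | x <- natC s].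
Proof.
by move=> /allP le_sn; rewrite /natC -!map_comp; apply/eq_in_map => k /le_sn /natrB.
Qed.

Lemma graph_spectrum_compl n s : all (leq^~ n) s ->
  graph_spectrum n (0 :: s) -> graph_spectrum n (0 :: [seq n - k | k <- s]).
Proof.
move=> le_sn [e [simp_e spec_e]]; exists (compl_rel e).
split; first exact: simple_compl.
by rewrite /natC map_cons -/(natC _) natC_sub //; apply: laplacian_spectrum_compl.
Qed.

Lemma graph_spectrum_disj m n s t :
  graph_spectrum m s -> graph_spectrum n t -> graph_spectrum (m + n) (s ++ t).
Proof.
move=> [e [simp_e spec_e]] [f [simp_f spec_f]]; exists (disj_rel e f).
split; first exact: simple_disj.
by rewrite /natC map_cat; apply: laplacian_spectrum_disj.
Qed.

Lemma laplacian_spectrum_K1 :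
  perm_eq (laplacian_spectrum (fun _ _ : 'I_1 => false)) (natC [:: 0]).
Proof.
apply/laplacian_spectrumP; rewrite big_seq1 /char_poly det_mx11 !mxE /degree.
by rewrite eq_card0 ?subr0 // => y; rewrite inE.
Qed.

Lemma graph_spectrum_K1 : graph_spectrum 1 [:: 0].
Proof. by exists (fun _ _ => false); split; last exact: laplacian_spectrum_K1. Qed.

Lemma graph_spectrum_K2 : graph_spectrum 2 [:: 0; 2].
Proof.
apply: (@graph_spectrum_compl 2 [:: 0]) => //.
exact: (graph_spectrum_disj graph_spectrum_K1 graph_spectrum_K1).
Qed.

(** Connectedness comes from the added isolated vertex, which the complement joins to all others. *)
Lemma realizable_compl_add_K1 n s : all (leq^~ n.+1) s -> graph_spectrum n s ->
  laplacian_realizable (natC (0 :: [seq n.+1 - k | k <- s])).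
Proof.
move=> le_sn [e [simp_e spec_e]].
pose g : rel 'I_(1 + n) := disj_rel (fun _ _ : 'I_1 => false) e.
have simp_g : simple_graph g by apply: simple_disj.
exists (1 + n), (compl_rel g); split; first exact: simple_compl.
- split=> // x y; have dom z : connect (compl_rel g) (lshift n ord0) z.
    have [<- // | neq_z] := eqVneq (lshift n ord0) z.
    apply: connect1; rewrite /compl_rel neq_z /g /disj_rel split_lshift.
    by case: (split z).
  have sym_c : connect_sym (compl_rel g).
    by apply: sym_connect_sym; case: (simple_compl simp_g).
  by apply: connect_trans (dom y); rewrite sym_c.
- rewrite /natC map_cons -/(natC _) natC_sub //.
  apply: laplacian_spectrum_compl => //.
  exact: (laplacian_spectrum_disj laplacian_spectrum_K1 spec_e).
Qed.

(** * Spectra containing an interval with one value left out *)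

Definition iota_except a m j : seq nat := [seq k <- iota a m | k != j].
Arguments iota_except : simpl never.

Lemma mem_iota_except a m j k :
  (k \in iota_except a m j) = (a <= k < a + m) && (k != j).
Proof. by rewrite mem_filter mem_iota andbC. Qed.

Lemma iota_except_uniq a m j : uniq (iota_except a m j).
Proof. by rewrite filter_uniq ?iota_uniq. Qed.

Lemma count_iota_except a m j k :
  count_mem k (iota_except a m j) = (a <= k < a + m) && (k != j).
Proof. by rewrite count_uniq_mem ?iota_except_uniq // mem_iota_except. Qed.

Lemma count_iota a m k : count_mem k (iota a m) = (a <= k < a + m).
Proof. by rewrite count_uniq_mem ?iota_uniq // mem_iota. Qed.

Lemma perm_count_mem (s t : seq nat) :
  (forall k, count_mem k s = count_mem k t) -> perm_eq s t.
Proof. by move=> eq_st; apply/allP => k _ /=; rewrite eq_st. Qed.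

Lemma iota_except_le a m n j : a + m <= n.+1 -> all (leq^~ n) (iota_except a m j).
Proof. by move=> le_mn; apply/allP => k; rewrite mem_iota_except; lia. Qed.

(** The reflection reverses the interval: its last value [a + m - 1] yields the new first one. *)
Lemma perm_map_sub_iota_except c a m j : a + m <= c.+1 -> j <= c ->
  perm_eq [seq c - k | k <- iota_except a m j]
          (iota_except (c.+1 - (a + m)) m (c - j)).
Proof.
move=> le_c le_jc; apply: uniq_perm (iota_except_uniq _ _ _) _ => [|k].
  rewrite map_inj_in_uniq ?iota_except_uniq // => x y.
  by rewrite !mem_iota_except; lia.
rewrite mem_iota_except; apply/mapP/idP => [[x] | k_m].
  by rewrite mem_iota_except; lia.
by exists (c - k); rewrite ?mem_iota_except; lia.
Qed.

Lemma odd_bin2S m : odd 'C(m.+1, 2) = odd m (+) odd 'C(m, 2).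
Proof. by rewrite binS bin1 oddD addbC. Qed.

Lemma graph_spectrum_compl_except n t a m j :
  all (leq^~ n) t -> a + m <= n.+1 -> j <= n ->
  graph_spectrum n (0 :: t ++ iota_except a m j) ->
  graph_spectrum n
    (0 :: [seq n - k | k <- t] ++ iota_except (n.+1 - (a + m)) m (n - j)).
Proof.
move=> le_tn le_amn le_jn gs_n.
have le_sn : all (leq^~ n) (t ++ iota_except a m j).
  by rewrite all_cat le_tn iota_except_le.
apply: graph_spectrum_perm (graph_spectrum_compl le_sn gs_n).
by rewrite perm_cons map_cat perm_cat2l perm_map_sub_iota_except.
Qed.

(* The hypotheses cleared are irrelevant but make lia intractably slow. *)
Ltac perm_by_count :=
  repeat match goal with
  | H : context [odd] |- _ => clear H
  | H : context [graph_spectrum] |- _ => clear H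
  end;
  apply: perm_count_mem => ? /=;
  rewrite ?count_cat /= ?count_iota_except ?count_iota; lia.

(** For [j > 1], add an isolated vertex to the graph of order [m - 1] omitting [m - j], then
    complement. For [j = 1] the value [m - 1] would be out of range, so the step goes back to order
    [m - 2] and adds an edge. *)
Lemma graph_spectrum_iota_except m j : 0 < j < m -> odd 'C(m.+1, 2) = odd j ->
  graph_spectrum m (0 :: iota_except 1 m j).
Proof.
elim/ltn_ind: m j => m IHm j.
have [-> | j_neq1] := eqVneq j 1.
  have [-> // | m_neq2] := eqVneq m 2; first by move=> _ _; exact: graph_spectrum_K2.
  case: m => [|[|[|m]]] // in IHm m_neq2 * => _.
  (* Parity excludes the original orders 3 and 4. *)
  have [-> // | m_neq0] := eqVneq m 0.
  have [-> // | m_neq1] := eqVneq m 1.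
  rewrite 2!odd_bin2S => par.
  have {}IHm : graph_spectrum m.+1 (0 :: iota_except 1 m.+1 2).
    by apply: IHm; [lia | lia | move: par => /=; case: odd; case: odd].
  have := graph_spectrum_disj graph_spectrum_K2 IHm.
  (* The eigenvalue 2 of the edge fills the gap; leaving out 0, which is outside the interval,
     removes nothing. *)
  have perm_s : perm_eq ([:: 0; 2] ++ 0 :: iota_except 1 m.+1 2)
                        (0 :: [:: 0] ++ iota_except 1 m.+1 0) by perm_by_count.
  move/(graph_spectrum_perm perm_s)/graph_spectrum_compl_except => gs.
  apply: graph_spectrum_perm (gs _ _ _) => //; try lia; perm_by_count.
case: m => [|m] in IHm *; first by rewrite ltn0 andbF.
rewrite odd_bin2S => j_m par.
have {}IHm : graph_spectrum m (0 :: iota_except 1 m (m.+1 - j)).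
  by apply: IHm; lia.
have := graph_spectrum_disj graph_spectrum_K1 IHm.
move/(@graph_spectrum_compl_except _ [:: 0]) => gs.
apply: graph_spectrum_perm (gs _ _ _) => //; try lia; perm_by_count.
Qed.

(* For j = m the obvious choice of a component on m vertices would need the
   spectrum 0, 1, .., m - 1, conjectured not to be realizable for m > 1; one of
   the isolated vertices is traded for an edge, whose eigenvalue 2 fills the gap
   in 0, 1, 3, .., m - 1. *)
Lemma graph_spectrum_three_components m j : 0 < j <= m -> odd 'C(m.+1, 2) = odd j ->
  graph_spectrum m.+2 (0 :: [:: 0; 0] ++ iota_except 1 m j).
Proof.
case/andP=> j_gt0; rewrite leq_eqVlt => /orP[/eqP jm | j_lt_m] par; last first.
  have gs := graph_spectrum_iota_except (introT andP (conj j_gt0 j_lt_m)) par.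
  exact: (graph_spectrum_disj graph_spectrum_K1
           (graph_spectrum_disj graph_spectrum_K1 gs)).
move: par; rewrite {}jm in j_gt0 *; case: m => // m in j_gt0 *.
rewrite odd_bin2S => par.
have [-> | m_neq0] := eqVneq m 0.
  exact: (graph_spectrum_disj graph_spectrum_K1
           (graph_spectrum_disj graph_spectrum_K1 graph_spectrum_K1)).
(* Here [par] makes ['C(m.+1, 2)] even, which excludes 1 and 2. *)
have m_gt2 : 2 < m by case: m => [|[|[|m]]] // in j_gt0 par m_neq0 *.
have gs : graph_spectrum m (0 :: iota_except 1 m 2).
  by apply: graph_spectrum_iota_except => //; move: par => /=; case: odd; case: odd.
apply: graph_spectrum_perm (graph_spectrum_disj graph_spectrum_K1
         (graph_spectrum_disj graph_spectrum_K2 gs)).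
perm_by_count.
Qed.

Lemma graph_spectrum_compl_add_K1 n t a m j :
  all (leq^~ n.+1) t -> a + m <= n.+2 -> j <= n.+1 ->
  graph_spectrum n (0 :: t ++ iota_except a m j) ->
  graph_spectrum n.+1 (0 :: (n.+1 :: [seq n.+1 - k | k <- t])
                         ++ iota_except (n.+2 - (a + m)) m (n.+1 - j)).
Proof.
move=> le_tn le_amn le_jn /(graph_spectrum_disj graph_spectrum_K1).
exact: (@graph_spectrum_compl_except _ (0 :: t)).
Qed.

Lemma laplacian_realizable_perm s t :
  perm_eq s t -> laplacian_realizable (natC s) -> laplacian_realizable (natC t).
Proof.
move=> st [n [e [simp_e conn_e spec_e]]]; exists n, e; split=> //.
exact: perm_trans spec_e (perm_map _ st).
Qed.

(** The double 2 descends from the two extra zeros of three components: successive complements turn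
    this pair into [m + 2], 1, [m + 3] and finally 2. Meanwhile the interval moves from [1..m] to
    [3..m+2], so that [m + 3] is missing at the end. *)
Lemma laplacian_realizable_two_twos m j : 0 < j <= m -> odd 'C(m.+1, 2) = odd j ->
  laplacian_realizable
    (natC ([:: 0; m + 5; 1; m + 4; 2; 2] ++ iota_except 3 m (j + 2))).
Proof.
move=> j_m par.
have gs2 : graph_spectrum m.+2
    (0 :: [:: m.+2; m.+2] ++ iota_except 2 m (m.+2 - j)).
  apply: graph_spectrum_perm (graph_spectrum_compl_except _ _ _
           (graph_spectrum_three_components j_m par)) => //; try lia; perm_by_count.
have gs3 : graph_spectrum m.+3 (0 :: [:: m.+3; 1; 1] ++ iota_except 2 m j.+1).
  apply: graph_spectrum_perm (graph_spectrum_compl_add_K1 _ _ _ gs2);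
    rewrite /= ?leqnSn //; try lia; perm_by_count.
have gs4 : graph_spectrum m.+4
    (0 :: [:: m.+4; 1; m.+3; m.+3] ++ iota_except 3 m (m.+3 - j)).
  apply: graph_spectrum_perm (graph_spectrum_compl_add_K1 _ _ _ gs3);
    rewrite /= ?leqnSn //; try lia; perm_by_count.
apply: laplacian_realizable_perm (realizable_compl_add_K1 _ gs4).
  rewrite perm_cons map_cons map_cat.
  apply: perm_trans (_ : perm_eq _ ([:: m.+4.+1; 1; m.+4; 2; 2] ++
    iota_except (m.+4.+2 - (3 + m)) m (m.+4.+1 - (m.+3 - j)))) _.
    have -> : [seq m.+4.+1 - k | k <- [:: m.+4; 1; m.+3; m.+3]] =
              [:: 1; m.+4; 2; 2] by rewrite /=; do ?congr (_ :: _); lia.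
    rewrite subn0 perm_cons perm_cat2l.
    by apply: perm_map_sub_iota_except; lia.
  perm_by_count.
by rewrite /= iota_except_le ?andbT; lia.
Qed.

(** * The multiset of the theorem and the parity of its sum *)

Lemma perm_rem2 (s t : seq nat) x y :
  perm_eq (x :: y :: s) t -> perm_eq s (rem y (rem x t)).
Proof.
move=> perm_st.
have x_t : x \in t by rewrite -(perm_mem perm_st) mem_head.
have perm_ys : perm_eq (y :: s) (rem x t).
  by rewrite -(perm_cons x) (perm_trans perm_st) ?perm_to_rem.
have y_t : y \in rem x t by rewrite -(perm_mem perm_ys) mem_head.
by rewrite -(perm_cons y) (perm_trans perm_ys) ?perm_to_rem.
Qed.

Lemma perm_S_ij_nm m i : 2 < i <= m + 2 ->
  perm_eq ([:: 0; m + 5; 1; m + 4; 2; 2] ++ iota_except 3 m i)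
          (S_ij_nm i (m + 5 - 2) (m + 5) 2).
Proof.
move=> i_m; apply: perm_rem2; perm_by_count.
Qed.

Lemma sumn_iota m n : sumn (iota m n) + 'C(m, 2) = 'C(m + n, 2).
Proof.
elim: n m => [|n IHn] m /=; first by rewrite addn0.
by rewrite addnS -addSn -IHn binS bin1; lia.
Qed.

(** The six values outside the interval sum to [2m + 14], and the full interval [3..m+2] sums to
    ['C(m + 3, 2) - 3 = 'C(m + 1, 2) + 2m]. *)
Lemma odd_sumn_S_ij_nm m i : 2 < i <= m + 2 ->
  odd (sumn (S_ij_nm i (m + 5 - 2) (m + 5) 2)) =
  odd 'C(m.+1, 2) (+) odd i.
Proof.
move=> i_m; rewrite -(perm_sumn (perm_S_ij_nm i_m)) sumn_cat.
have perm_i : perm_eq (i :: iota_except 3 m i) (iota 3 m) by perm_by_count.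
have := sumn_iota 3 m; rewrite -(perm_sumn perm_i) add3n.
move=> /(congr1 odd); rewrite 2!odd_bin2S.
move: (odd 'C(m.+1, 2)) => c; rewrite /= !oddD /=.
by case: (odd i); case: (odd m); case: c; case: (odd (sumn _)).
Qed.

Lemma odd_bin2 n : odd 'C(n, 2) = (n %% 4 == 2) || (n %% 4 == 3).
Proof.
rewrite bin2; have := divn_eq n 4; move: (ltn_pmod n (isT : 0 < 4)).
by case: (n %% 4) => [|[|[|[|]]]] //= _ ->; nia.
Qed.

End Constructions.

Theorem theorem4p3 (n i : nat)
    (hn : (6 <= n)%N) (hi : (1 < i < n - 2)%N) (hi2 : i <> 2%N) :
  laplacian_realizable (natC (S_ij_nm i (n - 2) n 2)) <->
  [\/ n = 0 %[mod 4] /\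
        (exists k : nat, (1 <= k <= (n - 6)./2)%N /\ i = (2 * k + 2)%N),
      n = 1 %[mod 4] /\
        (exists k : nat, (1 <= k <= (n - 5)./2)%N /\ i = (2 * k + 2)%N),
      n = 2 %[mod 4] /\
        (exists k : nat, (1 <= k <= (n - 4)./2)%N /\ i = (2 * k + 1)%N) |
      n = 3 %[mod 4] /\
        (exists k : nat, (1 <= k <= (n - 5)./2)%N /\ i = (2 * k + 1)%N)].
Proof.
(* [m] counts the values from 3 to [n - 3], the range of [i]. *)
have [m def_n] : exists m, n = m + 5 by exists (n - 5); lia.
rewrite {n}def_n in hn hi *.
have i_m : 2 < i <= m + 2 by lia.
have -> : laplacian_realizable (natC (S_ij_nm i (m + 5 - 2) (m + 5) 2)) <->
          odd 'C(m.+1, 2) = odd i.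
  split=> [[N [e [simp_e _ spec_e]]] | par].
    have := odd_sum_laplacian_spectrum simp_e spec_e.
    by rewrite odd_sumn_S_ij_nm // => /negbT; rewrite negb_add => /eqP.
  apply: laplacian_realizable_perm (perm_S_ij_nm i_m) _.
  have -> : i = i - 2 + 2 by lia.
  by apply: laplacian_realizable_two_twos; [lia | rewrite par oddB; lia].
(* As [m + 1 = n - 4] is congruent to [n] modulo 4, [i] is odd exactly for the residues 2 and 3. The
   bounds on [k] express [3 <= i <= n - 3] for [i] of the given parity. *)
rewrite odd_bin2; clear hn hi hi2; split=> [par | ].
  have := odd_double_half i; move: par; case: (odd i) => par def_i.
  - have [r0 | r1] : (m + 5) %% 4 = 2 \/ (m + 5) %% 4 = 3 by lia.
    + by constructor 3; split; [|exists i./2]; lia.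
    + by constructor 4; split; [|exists i./2]; lia.
  - have [r0 | r1] : (m + 5) %% 4 = 0 \/ (m + 5) %% 4 = 1 by lia.
    + by constructor 1; split; [|exists i./2.-1]; lia.
    + by constructor 2; split; [|exists i./2.-1]; lia.
by case=> -[r [k [k_m ->]]]; lia.
Qed.
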